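(* Let $\mathcal{E}$ be the expectation monad on $\mathbf{Set}$, i.e. the monad induced by the dual adjunction $\mathbf{Set}(-,[0,1])\dashv\mathbf{EMod}(-,[0,1])\colon\mathbf{EMod}^{\mathrm{op}}\to\mathbf{Set}$, so $\mathcal{E}X=\mathbf{EMod}([0,1]^X,[0,1])$ (which is in bijection with the set of finitely additive probability measures on $X$). Then $\mathcal{E}$ is the codensity monad of the functor $U_{\mathcal{D}_{\mathsf f}}\colon\mathbf{Kl}_{\mathsf f}(\mathcal{D}_{\mathsf f})\to\mathbf{Set}$.
   Context: An effect algebra is a partial commutative monoid $(A,\oplus,0)$ with an operation $(-)^\perp$ such that $x^\perp$ is the unique element with $x\oplus x^\perp=1$, where $1=0^\perp$, and $x\oplus1$ is defined iff $x=0$. $[0,1]$ is an effect algebra with $r\oplus s=r+s$ defined iff $r+s\le 1$ and $r^\perp=1-r$. An effect module is an effect algebra with a bilinear action $[0,1]\times E\to E$ satisfying $1\cdot x=x$, $(rs)x=r(sx)$; $\mathbf{EMod}$ is the category of effect modules and action-preserving maps preserving $\oplus,0,1$. $\mathbf{Set}(X,[0,1])=[0,1]^X$ carries the pointwise effect module structure. $\mathcal{D}_{\mathsf f}$ is the finite distribution monad on $\mathbf{Set}$ ($\mathcal{D}_{\mathsf f}X$ = finitely supported maps $p\colon X\to[0,1]$ with $\sum_x p(x)=1$); $\mathbf{Kl}_{\mathsf f}(\mathcal{D}_{\mathsf f})$ is the full subcategory of its Kleisli category on finite sets, and $U_{\mathcal{D}_{\mathsf f}}$ sends $X$ to $\mathcal{D}_{\mathsf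 f}X$ and $f\colon X\to\mathcal{D}_{\mathsf f}Y$ to $f^\#=\mu\circ\mathcal{D}_{\mathsf f}f$. The codensity monad of a functor $F$ is $\mathrm{Ran}_FF$ with its canonical monad structure; ''is the codensity monad'' means isomorphic as monads. *)

(* Defs.v *)
From mathcomp Require Import all_boot all_order all_algebra finmap.
From mathcomp Require Import all_classical all_reals.

Set Implicit Arguments.
Unset Strict Implicit.
Unset Printing Implicit Defensive.

Import Order.TTheory GRing.Theory Num.Theory.

Local Open Scope classical_set_scope.
Local Open Scope ring_scope.

Record category := Category {
  obj :> Type;
  chom : obj -> obj -> Type;
  idm : forall a, chom a a;
  ccomp : forall a b c, chom b c -> chom a b -> chom a c;
  ccompIm : forall a b (f : chom a b), ccomp (idm b) f = f;
  ccompmI : forall a b (f : chom a b), ccomp f (idm a) = f;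
  ccompA : forall a b c d (h : chom c d) (g : chom b c) (f : chom a b),
    ccomp h (ccomp g f) = ccomp (ccomp h g) f }.

Arguments chom {_} _ _.
Arguments idm {_} _.
Arguments ccomp {_ _ _ _} _ _.

Notation "g \c f" := (ccomp g f) (at level 50, left associativity).

Definition op_cat (C : category) : category :=
  {| obj := C;
     chom := fun a b => @chom C b a;
     idm := fun a => idm a;
     ccomp := fun a b c g f => f \c g;
     ccompIm := fun a b f => ccompmI f;
     ccompmI := fun a b f => ccompIm f;
     ccompA := fun a b c d h g f => esym (ccompA f g h) |}.

Definition full_subcat (C : category) (P : C -> Prop) : category :=
  {| obj := {a : C | P a};
     chom := fun a b => chom (sval a) (sval b);
     idm := fun a => idm (sval a);
     ccomp := fun a b c g f => g \c f;
     ccompIm := fun a b f => ccompIm f;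
     ccompmI := fun a b f => ccompmI f;
     ccompA := fun a b c d h g f => ccompA h g f |}.

Record functor (C D : category) := Functor {
  fobj :> C -> D;
  fmor : forall a b, chom a b -> chom (fobj a) (fobj b);
  fmorI : forall a, fmor (idm a) = idm (fobj a);
  fmorM : forall a b c (g : chom b c) (f : chom a b),
    fmor (g \c f) = fmor g \c fmor f }.

Arguments fmor {C D} _ {a b} _.

Definition idF (C : category) : functor C C :=
  {| fobj := fun a => a;
     fmor := fun a b f => f;
     fmorI := fun a => erefl;
     fmorM := fun a b c g f => erefl |}.

Definition compF (C D E : category) (G : functor D E) (F : functor C D) :
  functor C E.
Proof.
refine {| fobj := fun a => G (F a); fmor := fun a b f => fmor G (fmor F f) |}.
- by move=> a; rewrite !fmorI.
- by move=> a b c g f; rewrite !fmorM.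
Defined.

Definition full_incl (C : category) (P : C -> Prop) :
  functor (full_subcat P) C :=
  {| fobj := fun a : full_subcat P => sval a;
     fmor := fun a b f => f;
     fmorI := fun a => erefl;
     fmorM := fun a b c g f => erefl |}.

Record nattrans (C D : category) (F G : functor C D) := NatTrans {
  ntcomp :> forall a, chom (F a) (G a);
  natural : forall a b (f : chom a b),
    fmor G f \c ntcomp a = ntcomp b \c fmor F f }.

Record monad (C : category) := Monad {
  mfun :> functor C C;
  munit : nattrans (idF C) mfun;
  mmult : nattrans (compF mfun mfun) mfun;
  mmult_unitl : forall a, mmult a \c munit (mfun a) = idm (mfun a);
  mmult_unitr : forall a, mmult a \c fmor mfun (munit a) = idm (mfun a);
  mmultA : forall a,
    mmult a \c mmult (mfun a) = mmult a \c fmor mfun (mmult a) }.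

Arguments munit {C} _.
Arguments mmult {C} _.

Definition is_monad_morphism (C : category) (S T : monad C)
    (t : nattrans S T) : Prop :=
  (forall a, t a \c munit S a = munit T a) /\
  (forall a, t a \c mmult S a = mmult T a \c fmor T (t a) \c t (S a)).

Definition monads_isomorphic (C : category) (S T : monad C) : Prop :=
  exists (t : nattrans S T) (u : nattrans T S),
    [/\ is_monad_morphism t, is_monad_morphism u,
        forall a, u a \c t a = idm (S a) &
        forall a, t a \c u a = idm (T a)].

Record adjunction (C D : category) (L : functor C D) (G : functor D C) :=
  Adjunction {
    adj_unit : nattrans (idF C) (compF G L);
    adj_counit : nattrans (compF L G) (idF D);
    adj_trianglel : forall a,
      adj_counit (L a) \c fmor L (adj_unit a) = idm (L a);
    adj_triangler : forall b,
      fmor G (adj_counit b) \c adj_unit (G b) = idm (G b) }.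

Definition adj_mult (C D : category) (L : functor C D) (G : functor D C)
    (A : adjunction L G) :
  nattrans (compF (compF G L) (compF G L)) (compF G L).
Proof.
refine (@NatTrans C C (compF (compF G L) (compF G L)) (compF G L)
  (fun a => fmor G (adj_counit A (L a))) _).
by move=> a b f /=; rewrite -!fmorM (natural (adj_counit A) (fmor L f)).
Defined.

Definition monad_of_adjunction (C D : category) (L : functor C D)
  (G : functor D C) (A : adjunction L G) : monad C.
Proof.
refine {| mfun := compF G L; munit := adj_unit A; mmult := adj_mult A |}.
- by move=> a /=; rewrite adj_triangler.
- by move=> a /=; rewrite -fmorM adj_trianglel fmorI.
- move=> a /=; rewrite -!fmorM; congr (fmor G _).
  by have /= -> := natural (adj_counit A) (adj_counit A (L a)).
Defined.

Definition kleisli (C : category) (T : monad C) : category.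
Proof.
refine {| obj := C;
  chom := fun a b => @chom C a (T b);
  idm := fun a => munit T a;
  ccomp := fun a b c g f => mmult T c \c fmor T g \c f |}.
- by move=> a b f; rewrite mmult_unitr ccompIm.
- move=> a b f; rewrite -ccompA.
  have /= -> := natural (munit T) f.
  by rewrite ccompA mmult_unitl ccompIm.
- move=> a b c d h g f; rewrite !fmorM !ccompA -mmultA; congr (_ \c _).
  congr (_ \c _); rewrite -!ccompA; congr (_ \c _).
  by have /= -> := natural (mmult T) h.
Defined.

Definition kleisli_forget (C : category) (T : monad C) : functor (kleisli T) C.
Proof.
refine {| fobj := fun a : kleisli T => T a : C;
  fmor := fun (a b : kleisli T) (f : chom a b) => mmult T b \c fmor T f |}.
- by move=> a /=; rewrite mmult_unitr.
- move=> a b c g f /=; rewrite !fmorM !ccompA -mmultA; congr (_ \c _).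
  rewrite -!ccompA; congr (_ \c _).
  by have /= -> := natural (mmult T) g.
Defined.

Record right_kan (A B C : category) (K : functor A B) (F : functor A C) :=
  RightKan {
    ran :> functor B C;
    ran_counit : nattrans (compF ran K) F;
    ran_lift : forall G : functor B C,
      nattrans (compF G K) F -> nattrans G ran;
    ran_liftE : forall (G : functor B C) (g : nattrans (compF G K) F) a,
      ran_counit a \c ran_lift g (K a) = g a;
    ran_lift_uniq : forall (G : functor B C) (g : nattrans (compF G K) F)
      (d : nattrans G ran),
      (forall a, ran_counit a \c d (K a) = g a) ->
      forall b, d b = ran_lift g b }.

Arguments ran_counit {A B C K F} _.
Arguments ran_lift {A B C K F} _ {G} _.

Lemma ran_ext (A B C : category) (K : functor A B) (F : functor A C)
    (T : right_kan K F) (G : functor B C) (d e : nattrans G T) :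
  (forall a, ran_counit T a \c d (K a) = ran_counit T a \c e (K a)) ->
  forall b, d b = e b.
Proof.
move=> de b.
have nat_g a a' (f : chom a a') :
    fmor F f \c (ran_counit T a \c e (K a)) =
    ran_counit T a' \c e (K a') \c fmor (compF G K) f.
  rewrite ccompA natural /= -!ccompA; congr (_ \c _).
  exact: natural.
pose g := @NatTrans _ _ (compF G K) F
  (fun a => ran_counit T a \c e (K a)) nat_g.
rewrite (@ran_lift_uniq _ _ _ _ _ T _ g d)//.
by rewrite (@ran_lift_uniq _ _ _ _ _ T _ g e).
Qed.

Section Codensity.
Context (A B : category) (F : functor A B) (T : right_kan F F).

Definition codensity_unit_counit : nattrans (compF (idF B) F) F.
Proof.
refine (@NatTrans _ _ (compF (idF B) F) F (fun a => idm (F a)) _).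
by move=> a b f /=; rewrite ccompIm ccompmI.
Defined.

Definition codensity_mult_counit : nattrans (compF (compF T T) F) F.
Proof.
refine (@NatTrans _ _ (compF (compF T T) F) F
  (fun a => ran_counit T a \c fmor T (ran_counit T a)) _).
move=> a b f /=; rewrite ccompA.
have /= -> := natural (ran_counit T) f.
rewrite -!ccompA -!fmorM; congr (_ \c fmor T _).
exact: (natural (ran_counit T) f).
Defined.

Definition codensity_unit : nattrans (idF B) T :=
  ran_lift T codensity_unit_counit.

Definition codensity_mult : nattrans (compF T T) T :=
  ran_lift T codensity_mult_counit.

Lemma codensity_unitE a :
  ran_counit T a \c codensity_unit (F a) = idm (F a).
Proof. exact: ran_liftE codensity_unit_counit a. Qed.

Lemma codensity_multE a :
  ran_counit T a \c codensity_mult (F a) =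
  ran_counit T a \c fmor T (ran_counit T a).
Proof. exact: ran_liftE codensity_mult_counit a. Qed.

Definition id_nt : nattrans T T.
Proof.
refine (@NatTrans _ _ T T (fun b => idm (T b)) _).
by move=> a b f; rewrite ccompIm ccompmI.
Defined.

Lemma codensity_mult_unitl b :
  codensity_mult b \c codensity_unit (T b) = idm (T b).
Proof.
have nat_d a a' (f : chom a a') :
    fmor T f \c (codensity_mult a \c codensity_unit (T a)) =
    codensity_mult a' \c codensity_unit (T a') \c fmor T f.
  rewrite ccompA natural -!ccompA; congr (_ \c _).
  exact: (natural codensity_unit).
apply: (@ran_ext _ _ _ _ _ T _ (@NatTrans _ _ T T _ nat_d) id_nt) => a /=.
rewrite ccompmI ccompA codensity_multE -ccompA.
have /= -> := natural codensity_unit (ran_counit T a).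
by rewrite ccompA codensity_unitE ccompIm.
Qed.

Lemma codensity_mult_unitr b :
  codensity_mult b \c fmor T (codensity_unit b) = idm (T b).
Proof.
have nat_d a a' (f : chom a a') :
    fmor T f \c (codensity_mult a \c fmor T (codensity_unit a)) =
    codensity_mult a' \c fmor T (codensity_unit a') \c fmor T f.
  rewrite ccompA natural -!ccompA; congr (_ \c _) => /=.
  rewrite -!fmorM; congr (fmor T _); exact: (natural codensity_unit f).
apply: (@ran_ext _ _ _ _ _ T _ (@NatTrans _ _ T T _ nat_d) id_nt) => a /=.
rewrite ccompmI ccompA codensity_multE -ccompA -fmorM codensity_unitE fmorI.
exact: ccompmI.
Qed.

Lemma codensity_multA b :
  codensity_mult b \c codensity_mult (T b) =
  codensity_mult b \c fmor T (codensity_mult b).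
Proof.
have nat_d a a' (f : chom a a') :
    fmor T f \c (codensity_mult a \c codensity_mult (T a)) =
    codensity_mult a' \c codensity_mult (T a') \c
    fmor (compF T (compF T T)) f.
  rewrite ccompA natural -!ccompA; congr (_ \c _).
  exact: (natural codensity_mult).
have nat_e a a' (f : chom a a') :
    fmor T f \c (codensity_mult a \c fmor T (codensity_mult a)) =
    codensity_mult a' \c fmor T (codensity_mult a') \c
    fmor (compF T (compF T T)) f.
  rewrite ccompA natural -!ccompA; congr (_ \c _) => /=.
  rewrite -!fmorM; congr (fmor T _); exact: (natural codensity_mult f).
apply: (@ran_ext _ _ _ _ _ T (compF T (compF T T))
  (@NatTrans _ _ (compF T (compF T T)) T _ nat_d)
  (@NatTrans _ _ (compF T (compF T T)) T _ nat_e)) => a /=.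
rewrite !ccompA codensity_multE -!ccompA -fmorM codensity_multE fmorM.
have /= -> := natural codensity_mult (ran_counit T a).
by rewrite !ccompA codensity_multE.
Qed.

Definition codensity_monad : monad B :=
  {| mfun := T;
     munit := codensity_unit;
     mmult := codensity_mult;
     mmult_unitl := codensity_mult_unitl;
     mmult_unitr := codensity_mult_unitr;
     mmultA := codensity_multA |}.

End Codensity.

Definition is_codensity_monad (A B : category) (F : functor A B)
    (M : monad B) : Prop :=
  exists T : right_kan F F, monads_isomorphic M (codensity_monad T).

Definition set_cat : category :=
  {| obj := Type;
     chom := fun X Y => X -> Y;
     idm := fun X x => x;
     ccomp := fun X Y Z g f x => g (f x);
     ccompIm := fun X Y f => erefl;
     ccompmI := fun X Y f => erefl;
     ccompA := fun X Y Z W h g f => erefl |}.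

(* [None] means undefined; [osumC] and [osumA] are Kleene equalities: one side
   is defined iff the other is. *)
Record effect_algebra := EffectAlgebra {
  ea_sort :> Type;
  osum : ea_sort -> ea_sort -> option ea_sort;
  ea0 : ea_sort;
  compl : ea_sort -> ea_sort;
  osumC : forall x y, osum x y = osum y x;
  osumA : forall x y z,
    obind (fun w => osum x w) (osum y z) = obind (fun w => osum w z) (osum x y);
  osum0 : forall x, osum ea0 x = Some x;
  osum_compl : forall x, osum x (compl x) = Some (compl ea0);
  compl_uniq : forall x y, osum x y = Some (compl ea0) -> y = compl x;
  osum1 : forall x, osum x (compl ea0) <> None <-> x = ea0 }.

Arguments ea0 {_}.

Definition ea1 (E : effect_algebra) : E := compl ea0.
Arguments ea1 {_}.

Definition I01 (R : realType) : Type := {x : R | 0 <= x <= 1}.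

Section UnitInterval.
Context (R : realType).
Implicit Types r s t : I01 R.

Lemma I01_ge0 r : 0 <= val r.
Proof. by case/andP: (valP r). Qed.

Lemma I01_le1 r : val r <= 1.
Proof. by case/andP: (valP r). Qed.

Fact I01_zero_subproof : (0 : R) <= (0 : R) <= 1.
Proof. by rewrite lexx ler01. Qed.
Definition I01_zero : I01 R := exist _ 0 I01_zero_subproof.

Fact I01_one_subproof : (0 : R) <= (1 : R) <= 1.
Proof. by rewrite lexx ler01. Qed.
Definition I01_one : I01 R := exist _ 1 I01_one_subproof.

Fact I01_compl_subproof r : 0 <= 1 - val r <= 1.
Proof. by rewrite subr_ge0 I01_le1 gerBl I01_ge0. Qed.
Definition I01_compl r : I01 R := exist _ (1 - val r) (I01_compl_subproof r).

Fact I01_mul_subproof r s : 0 <= val r * val s <= 1.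
Proof. by rewrite mulr_ge0 ?I01_ge0// mulr_ile1 ?I01_ge0 ?I01_le1. Qed.
Definition I01_mul r s : I01 R :=
  exist _ (val r * val s) (I01_mul_subproof r s).

(* [insub] is [None] exactly when the sum leaves [0,1]. *)
Definition I01_osum r s : option (I01 R) := insub (val r + val s).

Lemma I01_osumP r s t : I01_osum r s = Some t <-> val r + val s = val t.
Proof.
rewrite /I01_osum; split; last by move=> ->; exact: valK.
by case: insubP => // u _ <- [->].
Qed.

Lemma I01_osum_def r s : (I01_osum r s : bool) = (val r + val s <= 1).
Proof.
rewrite /I01_osum; case: insubP => [u /andP[_ ->]//|] /=.
by rewrite addr_ge0 ?I01_ge0 //= => /negbTE.
Qed.

Lemma I01_osumC r s : I01_osum r s = I01_osum s r.
Proof. by rewrite /I01_osum addrC. Qed.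

Lemma I01_osumA r s t :
  obind (fun w => I01_osum r w) (I01_osum s t) =
  obind (fun w => I01_osum w t) (I01_osum r s).
Proof.
have H u v w : obind (fun z => I01_osum u z) (I01_osum v w) =
    insub (val u + val v + val w).
  rewrite -addrA {2}/I01_osum.
  case: insubP => [z _ zE|] /=; first by rewrite /I01_osum zE.
  rewrite addr_ge0 ?I01_ge0//= -ltNge => lt1.
  case: insubP => //= z /andP[_]; rewrite leNgt => /negP[].
  by rewrite (lt_le_trans lt1)// lerDr I01_ge0.
have -> : (fun w => I01_osum w t) = (fun w => I01_osum t w).
  by apply: funext => w; exact: I01_osumC.
by rewrite !H -[in RHS]addrA [in RHS]addrC.
Qed.

Lemma I01_osum0 r : I01_osum I01_zero r = Some r.
Proof. by apply/I01_osumP; rewrite /= add0r. Qed.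

Lemma I01_osum_compl r : I01_osum r (I01_compl r) = Some (I01_compl I01_zero).
Proof. by apply/I01_osumP; rewrite /= subr0 addrC subrK. Qed.

Lemma I01_compl_uniq r s :
  I01_osum r s = Some (I01_compl I01_zero) -> s = I01_compl r.
Proof.
move=> /I01_osumP /= e; apply: val_inj => /=.
by rewrite subr0 in e; apply/eqP; rewrite eq_sym subr_eq addrC e.
Qed.

Lemma I01_osum1 r : I01_osum r (I01_compl I01_zero) <> None <-> r = I01_zero.
Proof.
split=> [H|->]; last by rewrite I01_osum0.
apply: val_inj; apply: le_anti; rewrite I01_ge0 andbT /=.
move: H; have := I01_osum_def r (I01_compl I01_zero).
by case: I01_osum => //= u /esym; rewrite subr0 gerDr.
Qed.

Definition I01_ea : effect_algebra :=
  {| ea_sort := I01 R;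
     osum := I01_osum;
     ea0 := I01_zero;
     compl := I01_compl;
     osumC := I01_osumC;
     osumA := I01_osumA;
     osum0 := I01_osum0;
     osum_compl := I01_osum_compl;
     compl_uniq := I01_compl_uniq;
     osum1 := I01_osum1 |}.

End UnitInterval.

Arguments I01_zero {R}.
Arguments I01_one {R}.

Record effect_module (R : realType) := EffectModule {
  em_ea :> effect_algebra;
  act : I01 R -> em_ea -> em_ea;
  act_osuml : forall r s t x, I01_osum r s = Some t ->
    osum (act r x) (act s x) = Some (act t x);
  act_osumr : forall r x y z, osum x y = Some z ->
    osum (act r x) (act r y) = Some (act r z);
  act0l : forall x, act I01_zero x = ea0;
  act0r : forall r, act r ea0 = ea0;
  act1 : forall x, act I01_one x = x;
  actM : forall r s x, act (I01_mul r s) x = act r (act s x) }.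

Definition I01_em (R : realType) : effect_module R.
Proof.
refine {| em_ea := I01_ea R; act := @I01_mul R |}.
- by move=> r s t x /I01_osumP /= e; apply/I01_osumP; rewrite /= -e mulrDl.
- by move=> r x y z /I01_osumP /= e; apply/I01_osumP; rewrite /= -e mulrDr.
- by move=> x; apply: val_inj; rewrite /= mul0r.
- by move=> r; apply: val_inj; rewrite /= mulr0.
- by move=> x; apply: val_inj; rewrite /= mul1r.
- by move=> r s x; apply: val_inj; rewrite /= mulrA.
Defined.

Record emod_hom (R : realType) (M N : effect_module R) := EModHom {
  emod_fun :> M -> N;
  emod_osum : forall x y z, osum x y = Some z ->
    osum (emod_fun x) (emod_fun y) = Some (emod_fun z);
  emod0 : emod_fun ea0 = ea0;
  emod1 : emod_fun ea1 = ea1;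
  emod_act : forall r x, emod_fun (act r x) = act r (emod_fun x) }.

Section EMod.
Context (R : realType).
Implicit Types M N P : effect_module R.

Lemma emod_hom_ext M N (f g : emod_hom M N) : (forall x, f x = g x) -> f = g.
Proof.
case: f g => [f a b c d] [g a' b' c' d'] /= /funext fg.
move: a b c d a' b' c' d'; rewrite fg => *.
by congr EModHom; exact: Prop_irrelevance.
Qed.

Definition emod_id M : emod_hom M M.
Proof. by refine {| emod_fun := fun x => x |}. Defined.

Definition emod_comp M N P (g : emod_hom N P) (f : emod_hom M N) :
  emod_hom M P.
Proof.
refine {| emod_fun := fun x => g (f x) |}.
- by move=> x y z e; apply: emod_osum; exact: emod_osum.
- by rewrite !emod0.
- by rewrite !emod1.
- by move=> r x; rewrite !emod_act.
Defined.

Definition emod_cat : category.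
Proof.
refine {| obj := effect_module R; chom := @emod_hom R;
  idm := emod_id; ccomp := emod_comp |}.
- by move=> M N f; apply: emod_hom_ext.
- by move=> M N f; apply: emod_hom_ext.
- by move=> M N P Q h g f; apply: emod_hom_ext.
Defined.

End EMod.

Lemma option_ext (T : Type) (a b : option T) :
  (forall t, a = Some t <-> b = Some t) -> a = b.
Proof.
case: a => [a|] H; first by apply/esym/H.
by case: b H => [b|//] H; apply/H.
Qed.

Section Power.
Context (R : realType) (X : Type).
Implicit Types f g h : X -> I01 R.

Definition pow_osum f g : option (X -> I01 R) :=
  match pselect (exists h, forall x, I01_osum (f x) (g x) = Some (h x)) with
  | left e => Some (sval (cid e))
  | right _ => None
  end.

Lemma pow_osumP f g h :
  pow_osum f g = Some h <-> forall x, I01_osum (f x) (g x) = Some (h x).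
Proof.
rewrite /pow_osum; case: pselect => [e|n]; split => //.
- by case: (cid e) => k /= H [<-].
- case: (cid e) => k /= H H'; congr Some; apply: funext => x.
  by have := H x; rewrite H' => -[].
- by move=> H; case: n; exists h.
Qed.

Lemma pow_osum_def f g :
  pow_osum f g <> None <-> forall x, I01_osum (f x) (g x) <> None.
Proof.
split.
  case E : (pow_osum f g) => [h|]// _ x.
  by move/pow_osumP : E => ->.
move=> H E.
have H' x : {t | I01_osum (f x) (g x) = Some t}.
  by case: (I01_osum _ _) (H x) => [t _|//]; exists t.
have : pow_osum f g = Some (fun x => sval (H' x)).
  by apply/pow_osumP => x; exact: (svalP (H' x)).
by rewrite E.
Qed.

Lemma pow_osumC f g : pow_osum f g = pow_osum g f.
Proof.
by apply: option_ext => h; split=> /pow_osumP H; apply/pow_osumP => x;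
  rewrite I01_osumC.
Qed.

Lemma pow_osumA f g h :
  obind (fun w => pow_osum f w) (pow_osum g h) =
  obind (fun w => pow_osum w h) (pow_osum f g).
Proof.
have pt x := I01_osumA (f x) (g x) (h x).
apply: option_ext => k; split.
  case E : (pow_osum g h) => [w|]//= /pow_osumP fw.
  have /= {}pt x : obind (fun w => I01_osum w (h x)) (I01_osum (f x) (g x)) =
      Some (k x).
    by rewrite -pt; move/pow_osumP : E => -> /=.
  case E' : (pow_osum f g) => [v|] /=.
    by apply/pow_osumP => x; have := pt x; move/pow_osumP : E' => ->.
  exfalso; move: E'; apply/pow_osum_def => x e.
  by have := pt x; rewrite e.
case E : (pow_osum f g) => [w|]//= /pow_osumP fw.
have /= {}pt x : obind (fun w => I01_osum (f x) w) (I01_osum (g x) (h x)) =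
    Some (k x).
  by rewrite pt; move/pow_osumP : E => -> /=.
case E' : (pow_osum g h) => [v|] /=.
  by apply/pow_osumP => x; have := pt x; move/pow_osumP : E' => ->.
exfalso; move: E'; apply/pow_osum_def => x e.
by have := pt x; rewrite e.
Qed.

Definition pow_ea : effect_algebra.
Proof.
refine {| ea_sort := X -> I01 R;
  osum := pow_osum;
  ea0 := fun=> I01_zero;
  compl := fun f x => I01_compl (f x);
  osumC := pow_osumC;
  osumA := pow_osumA |}.
- by move=> f; apply/pow_osumP => x; exact: I01_osum0.
- by move=> f; apply/pow_osumP => x; exact: I01_osum_compl.
- by move=> f g /pow_osumP e; apply: funext => x; exact: I01_compl_uniq.
- move=> f; rewrite pow_osum_def; split=> [e|-> x]; last exact/I01_osum1.
  by apply: funext => x; exact/I01_osum1.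
Defined.

Definition pow_em : effect_module R.
Proof.
refine {| em_ea := pow_ea; act := fun r (f : pow_ea) x => I01_mul r (f x) |}.
- move=> r s t f e; apply/pow_osumP => x.
  exact: (@act_osuml R (I01_em R)).
- move=> r f g h /pow_osumP e; apply/pow_osumP => x.
  by apply: (@act_osumr R (I01_em R)); exact: e.
- by move=> f; apply: funext => x; exact: (@act0l R (I01_em R)).
- by move=> r; apply: funext => x; exact: (@act0r R (I01_em R)).
- by move=> f; apply: funext => x; exact: (@act1 R (I01_em R)).
- by move=> r s f; apply: funext => x; exact: (@actM R (I01_em R)).
Defined.

End Power.

Section Expectation.
Context (R : realType).

Definition pow_map (X Y : Type) (f : X -> Y) :
  emod_hom (pow_em R Y) (pow_em R X).
Proof.
refine {| emod_fun := fun (p : pow_em R Y) => (fun x => p (f x)) : pow_em R X |}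
  => //.
by move=> p q r /pow_osumP e; apply/pow_osumP => x.
Defined.

Definition set_I01 : functor set_cat (op_cat (emod_cat R)).
Proof.
refine {| fobj := fun X : set_cat => pow_em R X : op_cat (emod_cat R);
  fmor := fun (X Y : set_cat) (f : chom X Y) => pow_map f |}.
- by move=> X; apply: emod_hom_ext.
- by move=> X Y Z g f; apply: emod_hom_ext.
Defined.

Definition emod_I01 : functor (op_cat (emod_cat R)) set_cat.
Proof.
refine {| fobj := fun M : op_cat (emod_cat R) =>
            (emod_hom M (I01_em R) : Type) : set_cat;
  fmor := fun (M N : op_cat (emod_cat R)) (f : chom M N)
            (phi : emod_hom M (I01_em R)) => emod_comp phi f |}.
- by move=> M; apply: funext => phi; apply: emod_hom_ext.
- by move=> M N P g f; apply: funext => phi; apply: emod_hom_ext.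
Defined.

Definition ev_at (X : Type) (x : X) : emod_hom (pow_em R X) (I01_em R).
Proof.
refine {| emod_fun := fun (p : pow_em R X) => p x : I01_em R |} => //.
by move=> p q r /pow_osumP e; exact: e.
Defined.

Definition ev_mod (M : effect_module R) :
  emod_hom M (pow_em R (emod_hom M (I01_em R))).
Proof.
refine {| emod_fun := fun m =>
  (fun phi : emod_hom M (I01_em R) => phi m) : pow_em R _ |}.
- move=> x y z e; apply/pow_osumP => phi.
  exact: (emod_osum phi e).
- by apply: funext => phi; exact: (emod0 phi).
- by apply: funext => phi; exact: (emod1 phi).
- by move=> r x; apply: funext => phi; exact: (emod_act phi).
Defined.

Definition dual_unit : nattrans (idF set_cat) (compF emod_I01 set_I01).
Proof.
refine (@NatTrans _ _ (idF set_cat) (compF emod_I01 set_I01) (@ev_at) _).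
by move=> X Y f; apply: funext => x; apply: emod_hom_ext.
Defined.

Definition dual_counit :
  nattrans (compF set_I01 emod_I01) (idF (op_cat (emod_cat R))).
Proof.
refine (@NatTrans _ _ (compF set_I01 emod_I01) (idF (op_cat (emod_cat R)))
  ev_mod _).
by move=> M N f; apply: emod_hom_ext => m; apply: funext => phi.
Defined.

Definition dual_adjunction : adjunction set_I01 emod_I01.
Proof.
refine {| adj_unit := dual_unit; adj_counit := dual_counit |}.
- by move=> X; apply: emod_hom_ext => p; apply: funext => x.
- by move=> M; apply: funext => phi; apply: emod_hom_ext.
Defined.

Definition expectation_monad : monad set_cat :=
  monad_of_adjunction dual_adjunction.

Record fin_add_prob (X : Type) := FinAddProb {
  fap_fun :> set X -> I01 R;
  fap_setT : val (fap_fun setT) = 1;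
  fap_setU : forall A B, A `&` B = set0 ->
    val (fap_fun (A `|` B)) = val (fap_fun A) + val (fap_fun B) }.

Definition indicator (X : Type) (A : set X) : pow_em R X :=
  fun x => if `[< A x >] then I01_one else I01_zero.

Definition measure_of (X : Type) (phi : expectation_monad X) : fin_add_prob X.
Proof.
refine {| fap_fun := fun A =>
  (phi : emod_hom (pow_em R X) (I01_em R)) (indicator A) |}.
- have -> : indicator setT = ea1 :> pow_em R X.
    apply: funext => x; rewrite /indicator asboolT//.
    by apply: val_inj; rewrite /= subr0.
  by rewrite emod1 /= subr0.
- move=> A B AB0; apply/esym/I01_osumP.
  apply: (emod_osum phi); apply/pow_osumP => x; apply/I01_osumP.
  have : ~ (A x /\ B x) by move=> ABx; have : (A `&` B) x by []; rewrite AB0.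
  rewrite /indicator.
  case: (asboolP (A x)) (asboolP (B x)) (asboolP ((A `|` B) x)) =>
    [a|a] [b|b] [c|c] //= H; rewrite ?addr0 ?add0r//.
  all: by exfalso; rewrite /setU /= in c; tauto.
Defined.

End Expectation.

(* Sums range over [{classic X}], which is [X] with a choiceType structure. *)
Record dist (R : realType) (X : Type) := Dist {
  dist_fun :> X -> I01 R;
  dist_finite : finite_set [set x | val (dist_fun x) != 0];
  dist_sum1 : \sum_(x \in [set: {classic X}]) val (dist_fun x) = 1 }.

Section Dist.
Context (R : realType).

Lemma dist_ext (X : Type) (p q : dist R X) :
  (forall x, val (p x) = val (q x)) -> p = q.
Proof.
case: p q => [p a b] [q c d] /= H.
have {}H : p = q by apply: funext => x; apply: val_inj; exact: H.
move: a b c d; rewrite H => *.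
by congr Dist; exact: Prop_irrelevance.
Qed.

Definition expect (X : Type) (p : dist R X) (g : X -> R) : R :=
  \sum_(x \in [set: {classic X}]) val (p x) * g x.

Definition supp (X : Type) (p : dist R X) : {fset {classic X}} :=
  fset_set [set x : {classic X} | val (p x) != 0].

Lemma mem_supp (X : Type) (p : dist R X) (x : {classic X}) :
  (x \in supp p) = (val (p x) != 0).
Proof.
rewrite /supp in_fset_set; last exact: (dist_finite p).
by apply/idP/idP; rewrite inE.
Qed.

Lemma expectE (X : Type) (p : dist R X) (g : X -> R) (s : {fset {classic X}}) :
  {subset supp p <= s} -> expect p g = \sum_(x <- s) val (p x) * g x.
Proof.
move=> ps; rewrite /expect; apply: (@fsbigTE _ _ _ _ s) => x xs.
suff /eqP -> : val (p x) == 0 by rewrite mul0r.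
by apply: contraNT xs => px; apply: ps; rewrite mem_supp.
Qed.

Lemma expect_supp (X : Type) (p : dist R X) (g : X -> R) :
  expect p g = \sum_(x <- supp p) val (p x) * g x.
Proof. exact: expectE. Qed.

Lemma eq_expect (X : Type) (p : dist R X) (g h : X -> R) :
  (forall x, g x = h x) -> expect p g = expect p h.
Proof. by move=> /funext ->. Qed.

Lemma expect1 (X : Type) (p : dist R X) : expect p (fun=> 1) = 1.
Proof.
apply: etrans (dist_sum1 p); apply: eq_fsbigr => x _.
by rewrite mulr1.
Qed.

Lemma expect_I01 (X : Type) (p : dist R X) (g : X -> I01 R) :
  0 <= expect p (fun x => val (g x)) <= 1.
Proof.
apply/andP; split; last rewrite -[leRHS](expect1 p); rewrite !expect_supp.
  by apply: sumr_ge0 => x _; rewrite mulr_ge0 ?I01_ge0.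
by apply: ler_sum => x _; rewrite ler_wpM2l ?I01_ge0 ?I01_le1.
Qed.

Lemma delta_I01 (X : Type) (x y : X) :
  0 <= (`[< x = y >]%:R : R) <= 1.
Proof. by case: asboolP; rewrite ler01 lexx. Qed.

Lemma sum_delta (I : choiceType) (s : {fset I}) (x : I) (g : I -> R) :
  x \in s -> \sum_(y <- s) `[< x = y >]%:R * g y = g x.
Proof.
move=> xs; rewrite (bigD1_seq x)//= asboolT// mul1r big1 ?addr0// => y yx.
by rewrite asboolF ?mul0r// => xy; rewrite xy eqxx in yx.
Qed.

Definition dirac_dist (X : Type) (x : X) : dist R X.
Proof.
refine {| dist_fun := fun y => exist _ (`[< x = y >]%:R) (delta_I01 x y) |}.
- apply: (sub_finite_set _ (finite_set1 x)) => y /=.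
  by case: asboolP => //= _; rewrite eqxx.
- rewrite (@fsbigTE _ _ _ _ [fset (x : {classic X})]%fset) /=.
    by rewrite big_seq_fset1 asboolT.
  by move=> y; rewrite inE => /eqP yx; rewrite asboolF// => xy; apply: yx.
Defined.

Lemma expect_dirac (X : Type) (x : X) (g : X -> R) :
  expect (dirac_dist x) g = g x.
Proof.
rewrite (@expectE _ _ _ [fset (x : {classic X})]%fset).
  by rewrite big_seq_fset1 /= asboolT// mul1r.
move=> y; rewrite mem_supp /= inE.
by case: asboolP => [->//|]; rewrite eqxx.
Qed.

Section Bind.
Context (X Y : Type) (k : X -> dist R Y) (p : dist R X).

Definition bind_fun (y : Y) : I01 R :=
  exist _ (expect p (fun x => val (k x y))) (expect_I01 p (fun x => k x y)).

Definition bind_supp : {fset {classic Y}} :=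
  (\bigcup_(x <- supp p) supp (k x))%fset.

Lemma bind_fun_supp (y : {classic Y}) :
  val (bind_fun y) != 0 -> y \in bind_supp.
Proof.
move=> H; apply: contraNT H => /bigfcupP yn /=.
rewrite expect_supp big_seq big1// => x xp.
suff /eqP -> : val (k x y) == 0 by rewrite mulr0.
apply: contra_notT yn => kxy; exists x; first by rewrite xp.
by rewrite mem_supp.
Qed.

Lemma sum_bind (g : Y -> R) :
  \sum_(y <- bind_supp) val (bind_fun y) * g y =
  expect p (fun x => expect (k x) g).
Proof.
rewrite expect_supp /=.
under eq_bigr do rewrite expect_supp mulr_suml.
rewrite exchange_big /=; apply: eq_big_seq => x xp.
rewrite (@expectE _ (k x) g bind_supp).
  by rewrite mulr_sumr; apply: eq_bigr => y _; rewrite mulrA.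
by move=> y yk; apply/bigfcupP; exists x => //; rewrite xp.
Qed.

Definition bind_dist : dist R Y.
Proof.
refine {| dist_fun := bind_fun |}.
- apply: (sub_finite_set _ (finite_fset bind_supp)) => y /= H.
  exact: (@bind_fun_supp y).
- rewrite (@fsbigTE _ _ _ _ bind_supp).
    transitivity (\sum_(y <- bind_supp) val (bind_fun y) * 1).
      by apply: eq_bigr => y _; rewrite mulr1.
    rewrite sum_bind -[RHS](expect1 p); apply: eq_expect => x.
    exact: expect1.
  move=> y yn; apply/eqP; apply: contraNT yn; exact: bind_fun_supp.
Defined.

Lemma expect_bind (g : Y -> R) :
  expect bind_dist g = expect p (fun x => expect (k x) g).
Proof.
rewrite -sum_bind; apply: (@expectE _ bind_dist) => y.
by rewrite mem_supp; exact: bind_fun_supp.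
Qed.

Lemma bind_distE (y : Y) : val (bind_dist y) = expect p (fun x => val (k x y)).
Proof. by []. Qed.

End Bind.

Lemma bind_diracr (X : Type) (p : dist R X) : bind_dist (@dirac_dist X) p = p.
Proof.
apply: dist_ext => y; rewrite bind_distE /= /expect.
rewrite (@fsbigTE _ _ _ _ ((y : {classic X}) |` supp p)%fset).
  transitivity (\sum_(x <- ((y : {classic X}) |` supp p)%fset)
      `[< (y : {classic X}) = x >]%:R * val (p x)).
    apply: eq_bigr => x _; rewrite mulrC; congr (_%:R * _).
    by congr nat_of_bool; apply: asbool_equiv_eq; split.
  by apply: sum_delta; rewrite !inE eqxx.
move=> x; rewrite !inE negb_or mem_supp negbK => /andP[_ /eqP ->].
by rewrite mul0r.
Qed.

Lemma bind_diracl (X Y : Type) (k : X -> dist R Y) (x : X) :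
  bind_dist k (dirac_dist x) = k x.
Proof. by apply: dist_ext => y; rewrite bind_distE expect_dirac. Qed.

Lemma bind_distA (X Y Z : Type) (h : Y -> dist R Z) (k : X -> dist R Y)
    (p : dist R X) :
  bind_dist h (bind_dist k p) = bind_dist (fun x => bind_dist h (k x)) p.
Proof. by apply: dist_ext => z; rewrite !bind_distE expect_bind. Qed.

(* [map_dist f p] is [y |-> \sum_x p x * [f x = y]], the pushforward. *)
Definition map_dist (X Y : Type) (f : X -> Y) (p : dist R X) : dist R Y :=
  bind_dist (fun x => dirac_dist (f x)) p.

(* [flatten_dist P] is [x |-> \sum_p P p * p x]. *)
Definition flatten_dist (X : Type) (P : dist R (dist R X)) : dist R X :=
  bind_dist (fun p => p) P.

Lemma eq_bind_dist (X Y : Type) (h k : X -> dist R Y) (p : dist R X) :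
  (forall x, h x = k x) -> bind_dist h p = bind_dist k p.
Proof. by move=> /funext ->. Qed.

Lemma bind_map_dist (X Y Z : Type) (k : Y -> dist R Z) (f : X -> Y)
    (p : dist R X) :
  bind_dist k (map_dist f p) = bind_dist (fun x => k (f x)) p.
Proof.
rewrite /map_dist bind_distA; apply: eq_bind_dist => x.
exact: (bind_diracl k (f x)).
Qed.

Lemma map_dist_id (X : Type) (p : dist R X) : map_dist (fun x => x) p = p.
Proof. exact: bind_diracr. Qed.

Lemma map_dist_comp (X Y Z : Type) (g : Y -> Z) (f : X -> Y) (p : dist R X) :
  map_dist (fun x => g (f x)) p = map_dist g (map_dist f p).
Proof. by rewrite {2}/map_dist bind_map_dist. Qed.

Lemma map_dirac_dist (X Y : Type) (f : X -> Y) (x : X) :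
  map_dist f (dirac_dist x) = dirac_dist (f x).
Proof. exact: (bind_diracl (fun x => dirac_dist (f x)) x). Qed.

Lemma map_flatten_dist (X Y : Type) (f : X -> Y) (P : dist R (dist R X)) :
  map_dist f (flatten_dist P) = flatten_dist (map_dist (map_dist f) P).
Proof.
rewrite [RHS](bind_map_dist (fun p => p)).
exact: (bind_distA (fun x => dirac_dist (f x)) (fun p => p) P).
Qed.

Lemma flatten_dirac_dist (X : Type) (p : dist R X) :
  flatten_dist (dirac_dist p) = p.
Proof. exact: (bind_diracl (fun p => p) p). Qed.

Lemma flatten_map_dirac_dist (X : Type) (p : dist R X) :
  flatten_dist (map_dist (@dirac_dist X) p) = p.
Proof.
rewrite [LHS](bind_map_dist (fun p => p)).
exact: bind_diracr.
Qed.

Lemma flatten_flatten_dist (X : Type) (P : dist R (dist R (dist R X))) :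
  flatten_dist (flatten_dist P) = flatten_dist (map_dist (@flatten_dist X) P).
Proof.
rewrite [RHS](bind_map_dist (fun p => p)).
exact: (bind_distA (fun p => p) (fun p => p) P).
Qed.

Definition dist_functor : functor set_cat set_cat.
Proof.
refine {| fobj := fun X : set_cat => (dist R X : Type) : set_cat;
  fmor := fun (X Y : set_cat) (f : chom X Y) => @map_dist X Y f |}.
- by move=> X; apply: funext; exact: map_dist_id.
- by move=> X Y Z g f; apply: funext; exact: map_dist_comp.
Defined.

Definition dist_unit : nattrans (idF set_cat) dist_functor.
Proof.
refine (@NatTrans _ _ (idF set_cat) dist_functor (@dirac_dist) _).
by move=> X Y f; apply: funext; exact: map_dirac_dist.
Defined.

Definition dist_mult : nattrans (compF dist_functor dist_functor) dist_functor.
Proof.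
refine (@NatTrans _ _ (compF dist_functor dist_functor) dist_functor
  (@flatten_dist) _).
by move=> X Y f; apply: funext; exact: map_flatten_dist.
Defined.

Definition dist_monad : monad set_cat.
Proof.
refine {| mfun := dist_functor; munit := dist_unit; mmult := dist_mult |}.
- by move=> X; apply: funext; exact: flatten_dirac_dist.
- by move=> X; apply: funext; exact: flatten_map_dirac_dist.
- by move=> X; apply: funext; exact: flatten_flatten_dist.
Defined.

Definition is_finite (X : Type) : Prop := finite_set [set: X].

Definition fin_kleisli_dist : category :=
  full_subcat (is_finite : kleisli dist_monad -> Prop).

Definition forget_fin_kleisli_dist : functor fin_kleisli_dist set_cat :=
  compF (kleisli_forget dist_monad)
    (full_incl (is_finite : kleisli dist_monad -> Prop)).

End Dist.

(* Main.v *)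
(* Codensity: write U for the forgetful functor.  The counit of the Kan extension
   sends a state phi on [0,1]^(D Y), Y finite, to the distribution
   y |-> phi (d |-> d y).  A predicate p : X -> [0,1] is the same thing as a map
   X -> D 2, so for a functor G with g : G U -> U the only possible lift sends
   t in G X to the state p |-> g_2 (G p t) true.  That this respects the effect
   module operations follows by factoring the predicates involved through a
   common map X -> D Y and using naturality of g along Kleisli maps Y -> D 2.
   The identity is then the isomorphism of monads.

   Measures: a state is determined on indicators because it is monotone and
   every predicate is uniformly approximated by simple ones.  Conversely the
   lower integral L is superadditive, and uniform approximation gives
   L (- p) = - L p, so that L is additive. *)

Require Import Defs.
From mathcomp Require Import all_boot all_order all_algebra finmap.
From mathcomp Require Import all_classical all_reals.
From mathcomp Require Import lra.

Set Implicit Arguments.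
Unset Strict Implicit.
Unset Printing Implicit Defensive.

Import Order.TTheory GRing.Theory Num.Theory.

Local Open Scope classical_set_scope.
Local Open Scope ring_scope.

Definition in01 (R : realType) (r : R) (r01 : 0 <= r <= 1) : I01 R :=
  exist _ r r01.

(** * Distributions on finite types *)

Section FiniteDist.
Context (R : realType).

Lemma fsum_finType (T : finType) (F : T -> R) :
  \sum_(x \in [set: {classic T}]) F x = \sum_(x : T) F x.
Proof.
rewrite (reindex_fsbigT (fun x : T => x : {classic T})); last first.
  by exists (fun x : {classic T} => x : T).
rewrite (@fsbig_seq _ _ _ _ (index_enum T)) ?index_enum_uniq//.
by apply: eq_fsbigl; apply/seteqP; split=> x //= _; exact: mem_index_enum.
Qed.

Lemma finType_is_finite (T : finType) : Defs.is_finite T.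
Proof. exact: (@finite_finset T [set: T]). Qed.

Definition fin_dist (T : finType) (d : T -> I01 R)
  (d1 : \sum_x val (d x) = 1) : dist R T.
Proof.
refine {| dist_fun := d |}.
- exact: (@finite_finset T).
- by rewrite fsum_finType.
Defined.

Lemma expect_finType (T : finType) (p : dist R T) (g : T -> R) :
  expect p g = \sum_x val (p x) * g x.
Proof. exact: fsum_finType. Qed.

Definition bern_fun (r : I01 R) (b : bool) : I01 R :=
  if b then r else I01_compl r.

Fact bern_sum1 (r : I01 R) : \sum_b val (bern_fun r b) = 1.
Proof. by rewrite big_bool /= addrC subrK. Qed.

Definition bern (r : I01 R) : dist R bool := fin_dist (bern_sum1 r).

(** The two masses add up to 1. Together with [bern] this identifies D 2 with [0,1]. *)
Lemma dist_bool_ext (p q : dist R bool) : val (p true) = val (q true) -> p = q.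
Proof.
have H (d : dist R bool) : val (d true) + val (d false) = 1.
  rewrite -[RHS](expect1 d) expect_finType big_bool /=.
  by rewrite !mulr1.
move=> e; apply: dist_ext => -[//|].
by apply: (addrI (val (p true))); rewrite H e H.
Qed.

Definition expect01 (X : Type) (p : dist R X) (u : X -> I01 R) : I01 R :=
  in01 (expect_I01 p u).

End FiniteDist.

(** Change of variables. As [flatten_dist] is pointwise an expectation, this also computes, at each
    point, the action of a Kleisli map on a distribution. *)
Lemma expect_map (R : realType) (X Y : Type) (f : X -> Y) (p : dist R X)
    (g : Y -> R) :
  expect (map_dist f p) g = expect p (fun x => g (f x)).
Proof.
by rewrite expect_bind; apply: eq_expect => x; rewrite expect_dirac.
Qed.

(** * Finite linearity and monotonicity of states *)

Section StateLemmas.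
Context (R : realType) (X : Type).
Implicit Types (phi : emod_hom (pow_em R X) (I01_em R)) (p q r : X -> I01 R).

Lemma state_add phi p q r :
  (forall x, val (p x) + val (q x) = val (r x)) ->
  val (phi p) + val (phi q) = val (phi r).
Proof.
move=> pqr; apply/I01_osumP; apply: (emod_osum phi).
by apply/pow_osumP => x; exact/I01_osumP.
Qed.

Lemma state0 phi : val (phi (fun=> I01_zero)) = 0.
Proof. by have -> := emod0 phi. Qed.

Lemma state1 phi : val (phi (fun=> I01_one)) = 1.
Proof.
have -> : (fun=> I01_one) = ea1 :> pow_em R X.
  by apply: funext => x; apply: val_inj; rewrite /= subr0.
by rewrite (emod1 phi) /= subr0.
Qed.

Lemma state_scale phi (a : I01 R) p q :
  (forall x, val a * val (p x) = val (q x)) ->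
  val a * val (phi p) = val (phi q).
Proof.
move=> apq; have -> : q = act a (p : pow_em R X).
  by apply: funext => x; apply: val_inj; rewrite -apq.
by rewrite (emod_act phi).
Qed.

(** [q] is the sum of [p] and the predicate [q - p], on which [phi] is nonnegative. *)
Lemma state_le phi p q :
  (forall x, val (p x) <= val (q x)) -> val (phi p) <= val (phi q).
Proof.
move=> pq; have d01 x : 0 <= val (q x) - val (p x) <= 1.
  by rewrite subr_ge0 pq (le_trans _ (I01_le1 (q x)))// gerBl I01_ge0.
rewrite -(@state_add phi p (fun x => in01 (d01 x)) q) ?lerDl ?I01_ge0//.
by move=> x /=; rewrite addrC subrK.
Qed.

Lemma state_sum (I : Type) (s : seq I) phi (a : I -> I01 R)
    (p : I -> X -> I01 R) (q : X -> I01 R) :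
  (forall x, \sum_(i <- s) val (a i) * val (p i x) = val (q x)) ->
  \sum_(i <- s) val (a i) * val (phi (p i)) = val (phi q).
Proof.
elim: s q => [|i s IHs] q sq.
  rewrite big_nil -[LHS](state0 phi); congr (val (phi _)).
  by apply: funext => x; apply: val_inj; rewrite -sq big_nil.
(* The tail is dominated by [q], so it is again a predicate and the induction hypothesis applies to
   it. *)
have tail01 x : 0 <= \sum_(j <- s) val (a j) * val (p j x) <= 1.
  rewrite sumr_ge0/= => [|j _]; last by rewrite mulr_ge0 ?I01_ge0.
  apply: le_trans (I01_le1 (q x)); rewrite -sq big_cons lerDr.
  by rewrite mulr_ge0 ?I01_ge0.
rewrite big_cons (IHs (fun x => in01 (tail01 x)))//.
rewrite (@state_scale phi _ _ (fun x => I01_mul (a i) (p i x)))//.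
by apply: state_add => x; rewrite -sq big_cons.
Qed.

End StateLemmas.

(** * Uniform approximation by simple predicates *)

Section Approximation.
Context (R : realType) (X : Type) (p : X -> I01 R) (n : nat).

(** The floor of (n+1) p(x) runs from 0 to n+1, the last value occurring where p(x) = 1; hence n+2
    indices, and [inord] is always in range. *)
Definition approx_idx (x : X) : 'I_n.+2 :=
  inord (Num.truncn (val (p x) * n.+1%:R)).

Fact approx_val_subproof (k : 'I_n.+2) : 0 <= (k%:R / n.+1%:R : R) <= 1.
Proof.
rewrite divr_ge0//= ler_pdivrMr// mul1r ler_nat -ltnS; exact: ltn_ord.
Qed.

Definition approx_val (k : 'I_n.+2) : I01 R := in01 (approx_val_subproof k).

Lemma approx_bounds x :
  val (approx_val (approx_idx x)) <= val (p x) <=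
  val (approx_val (approx_idx x)) + n.+1%:R^-1.
Proof.
have p0 : 0 <= val (p x) * n.+1%:R by rewrite mulr_ge0 ?I01_ge0.
have /andP[lo hi] := truncn_itv p0.
have idxE : approx_idx x = Num.truncn (val (p x) * n.+1%:R) :> nat.
  apply: inordK; rewrite ltnS -(ler_nat R) (le_trans lo)//.
  by rewrite ler_piMl ?I01_le1.
rewrite /= idxE ler_pdivrMr// lo /= -[X in _ + X]mul1r -mulrDl ler_pdivlMr//.
by rewrite natr1 ltW.
Qed.

End Approximation.

Lemma le0_invn (R : realType) (d : R) : (forall n, d <= n.+1%:R^-1) -> d <= 0.
Proof.
move=> H; rewrite leNgt; apply/negP => d0.
(* For n the floor of 1/d, n+1 exceeds 1/d, so 1/(n+1) is below d. *)
have := H (Num.truncn d^-1); rewrite leNgt => /negP[].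
by rewrite -[ltRHS]invrK ltf_pV2 ?posrE ?invr_gt0// truncnS_gt.
Qed.

(** * States are determined by indicators *)

Section StateDetermined.
Context (R : realType) (X : Type).
Implicit Types phi psi : emod_hom (pow_em R X) (I01_em R).

Lemma state_simple phi (T : finType) (h : X -> T) (u : T -> I01 R) :
  val (phi (fun x => u (h x))) =
  \sum_y val (u y) * val (phi (indicator R [set x | h x = y])).
Proof.
apply/esym/state_sum => x; rewrite (bigD1 (h x))//= big1 => [|y yh].
  by rewrite addr0 /indicator asboolT// mulr1.
by rewrite /indicator asboolF ?mulr0// => hxy; rewrite -hxy eqxx in yh.
Qed.

Lemma state_approx phi (p : X -> I01 R) n :
  val (phi p) <=
  val (phi (fun x => approx_val R (approx_idx p n x))) + n.+1%:R^-1.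
Proof.
set s : X -> I01 R := (fun x => approx_val R _).
have sp x : val (s x) <= val (p x) <= val (s x) + n.+1%:R^-1.
  exact: approx_bounds.
have d01 x : 0 <= val (p x) - val (s x) <= 1.
  have /andP[sx _] := sp x.
  by rewrite subr_ge0 sx (le_trans _ (I01_le1 (p x)))// gerBl I01_ge0.
have n01 : 0 <= (n.+1%:R^-1 : R) <= 1.
  by rewrite invr_ge0 ler0n invf_le1 ?ler1n ?ltr0n.
rewrite -(@state_add _ _ phi s (fun x => in01 (d01 x)) p) => [|x]; last first.
  by rewrite /= addrC subrK.
(* The error [p - s] lies below the constant 1/(n+1), which is a multiple of the unit. *)
rewrite lerD2l (@le_trans _ _ (val (phi (fun=> in01 n01))))//.
  by apply: state_le => x /=; rewrite lerBlDl; case/andP: (sp x).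
rewrite -(@state_scale _ _ phi (in01 n01) (fun=> I01_one)) => [|x].
  by rewrite state1 mulr1.
by rewrite /= mulr1.
Qed.

Lemma state_ext phi psi :
  (forall A, phi (indicator R A) = psi (indicator R A)) -> phi = psi.
Proof.
move=> ind; apply: emod_hom_ext => p; apply: val_inj.
suff le_state (f g : emod_hom (pow_em R X) (I01_em R)) :
    (forall A, f (indicator R A) = g (indicator R A)) ->
    val (f p) <= val (g p).
  by apply/le_anti/andP; split; apply: le_state.
move=> fg; rewrite -subr_le0; apply: le0_invn => n.
rewrite lerBlDl (le_trans (state_approx f p n))// lerD2r.
(* [f] and [g] agree on the simple approximation, which lies below [p]. *)
rewrite state_simple; under eq_bigr do rewrite fg; rewrite -state_simple.
by apply: state_le => x; case/andP: (approx_bounds p n x).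
Qed.

End StateDetermined.


(** * Integration against a finitely additive probability measure *)

Section SimpleIntegral.
Context (R : realType) (X : Type) (mu : fin_add_prob R X).
Implicit Types T : finType.

Lemma fap_set0 : val (mu set0) = 0.
Proof.
have := fap_setU mu (setI0 set0).
by rewrite setU0 => /eqP; rewrite addrC -subr_eq subrr eq_sym => /eqP.
Qed.

Lemma fap_pred T (h : X -> T) (A : pred T) :
  val (mu [set x | A (h x)]) = \sum_(y | A y) val (mu [set x | h x = y]).
Proof.
have fap_seq (s : seq T) : uniq s ->
    val (mu [set x | h x \in s]) = \sum_(y <- s) val (mu [set x | h x = y]).
  elim: s => [_|y s IHs /= /andP[ys us]].
    rewrite big_nil -[RHS]fap_set0; congr (val (mu _)).
    by apply/seteqP; split.
  rewrite big_cons -IHs// -fap_setU.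
    congr (val (mu _)); apply/seteqP; split=> x /=; rewrite inE.
      by case/orP => [/eqP|]; [left|right].
    by case=> [->|->]; rewrite ?eqxx ?orbT.
  by apply/seteqP; split=> x //= -[->]; rewrite (negbTE ys).
rewrite -big_enum -fap_seq ?enum_uniq//; congr (val (mu _)).
by apply/seteqP; split=> x /=; rewrite mem_enum.
Qed.

Definition simple_int T (h : X -> T) (u : T -> R) : R :=
  \sum_y val (mu [set x | h x = y]) * u y.

(** A fibre of the composite is a finite disjoint union of fibres of [h]. This brings two simple
    functions onto a common partition. *)
Lemma simple_int_comp T T' (h : X -> T) (g : T -> T') (u : T' -> R) :
  simple_int (fun x => g (h x)) u = simple_int h (fun y => u (g y)).
Proof.
rewrite /simple_int [RHS](partition_big g predT)//=; apply: eq_bigr => z _.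
have -> : [set x | g (h x) = z] = [set x | g (h x) == z].
  by apply/seteqP; split=> x /eqP.
rewrite (fap_pred h (fun y => g y == z)) mulr_suml.
by apply: eq_bigr => y /eqP ->.
Qed.

Lemma simple_int_le T (h : X -> T) (u v : T -> R) :
  (forall x, u (h x) <= v (h x)) -> simple_int h u <= simple_int h v.
Proof.
move=> uv; apply: ler_sum => y _.
have [[x <-]|hy] := pselect (exists x, h x = y).
  by rewrite ler_wpM2l ?I01_ge0.
(* Off the image of [h] the values of [u] and [v] are not compared, but there the fibre is empty and
   has mass 0. *)
rewrite [X in mu X](_ : _ = set0) ?fap_set0 ?mul0r//.
by apply/seteqP; split=> x //= hxy; apply: hy; exists x.
Qed.

Lemma simple_int_cst T (h : X -> T) (c : R) : simple_int h (fun=> c) = c.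
Proof.
rewrite /simple_int -mulr_suml -(fap_pred h predT) /=.
by rewrite [X in mu X](_ : _ = setT) ?fap_setT ?mul1r//; exact/seteqP.
Qed.

Lemma simple_intD T (h : X -> T) (u v : T -> R) :
  simple_int h (fun y => u y + v y) = simple_int h u + simple_int h v.
Proof.
by rewrite /simple_int -big_split; apply: eq_bigr => y _; rewrite mulrDr.
Qed.

Lemma simple_intZ T (h : X -> T) (a : R) (u : T -> R) :
  simple_int h (fun y => a * u y) = a * simple_int h u.
Proof.
by rewrite /simple_int mulr_sumr; apply: eq_bigr => y _; rewrite mulrCA.
Qed.

Lemma simple_intN T (h : X -> T) (u : T -> R) :
  simple_int h (fun y => - u y) = - simple_int h u.
Proof. by rewrite /simple_int -sumrN; apply: eq_bigr => y _; rewrite mulrN. Qed.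

(** * Lower integrals of bounded functions *)

Definition bounded_fun (f : X -> R) := exists M, forall x, `|f x| <= M.

Lemma bounded_funD f g :
  bounded_fun f -> bounded_fun g -> bounded_fun (fun x => f x + g x).
Proof.
move=> [M fM] [N gN]; exists (M + N) => x.
by rewrite (le_trans (ler_normD _ _))// lerD.
Qed.

Lemma bounded_funN f : bounded_fun f -> bounded_fun (fun x => - f x).
Proof. by move=> [M fM]; exists M => x; rewrite normrN. Qed.

Lemma bounded_funZ a f : bounded_fun f -> bounded_fun (fun x => a * f x).
Proof.
by move=> [M fM]; exists (`|a| * M) => x; rewrite normrM ler_wpM2l.
Qed.

Lemma bounded_I01 (p : X -> I01 R) : bounded_fun (fun x => val (p x)).
Proof. by exists 1 => x; rewrite ger0_norm ?I01_ge0 ?I01_le1. Qed.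

Definition lower_sums (f : X -> R) : set R :=
  [set r | exists (T : finType) (h : X -> T) (u : T -> R),
    (forall x, u (h x) <= f x) /\ r = simple_int h u].

(** For bounded [f] the lower sums are nonempty and bounded above, so [sup] is a genuine
    supremum. *)
Definition lower_int (f : X -> R) : R := sup (lower_sums f).

Lemma lower_int_ge f T (h : X -> T) (u : T -> R) :
  bounded_fun f -> (forall x, u (h x) <= f x) -> simple_int h u <= lower_int f.
Proof.
move=> [M fM] uf; apply: ub_le_sup; last by exists T, h, u.
exists M => _ [T' [h' [v [vf ->]]]]; rewrite -[leRHS](simple_int_cst h').
apply: simple_int_le => x.
by rewrite (le_trans (vf x))// (le_trans (ler_norm _)).
Qed.

Lemma lower_int_le f c : bounded_fun f ->
  (forall T (h : X -> T) (u : T -> R),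
    (forall x, u (h x) <= f x) -> simple_int h u <= c) ->
  lower_int f <= c.
Proof.
move=> [M fM] H; apply: ge_sup => [|_ [T [h [u [uf ->]]]]]; last exact: H.
exists (simple_int (fun=> tt) (fun=> - M)), unit, (fun=> tt), (fun=> - M).
by split=> // x; rewrite lerNl (le_trans _ (fM x))// ler_normr lexx orbT.
Qed.

Lemma lower_int_superadd f g : bounded_fun f -> bounded_fun g ->
  lower_int f + lower_int g <= lower_int (fun x => f x + g x).
Proof.
move=> bf bg; rewrite -lerBrDr; apply: lower_int_le => // T h u uf.
rewrite lerBrDr addrC -lerBrDr; apply: lower_int_le => // T' h' v vg.
rewrite lerBrDr.
(* The pairing of [h] and [h'] is a common refinement, on which the two integrals add up. *)
rewrite (simple_int_comp (fun x => (h x, h' x)) snd v).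
rewrite (simple_int_comp (fun x => (h x, h' x)) fst u) -simple_intD.
apply: lower_int_ge => [|x /=]; first exact: bounded_funD.
by rewrite addrC lerD.
Qed.

Lemma lower_int_scale_le a f : 0 < a -> bounded_fun f ->
  a * lower_int f <= lower_int (fun x => a * f x).
Proof.
move=> a0 bf; rewrite mulrC -ler_pdivlMr//; apply: lower_int_le => // T h u uf.
rewrite ler_pdivlMr// mulrC -simple_intZ.
apply: lower_int_ge => [|x]; first exact: bounded_funZ.
by rewrite ler_pM2l.
Qed.

Lemma lower_int_cst c : lower_int (fun=> c) = c.
Proof.
have bc : bounded_fun (fun=> c) by exists `|c|.
apply/eqP; rewrite eq_le; apply/andP; split.
  apply: lower_int_le => // T h u uc.
  by rewrite -[leRHS](simple_int_cst h); exact: simple_int_le.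
by rewrite -[leLHS](simple_int_cst (fun=> tt)); exact: lower_int_ge.
Qed.

Lemma lower_intN (p : X -> I01 R) :
  lower_int (fun x => - val (p x)) = - lower_int (fun x => val (p x)).
Proof.
have bp := bounded_I01 p; have bNp := bounded_funN bp.
apply/eqP; rewrite eq_le; apply/andP; split.
  (* Superadditivity for [- p] and [p], whose sum is 0. *)
  rewrite -subr_le0 opprK -[leRHS](lower_int_cst 0).
  apply: le_trans (lower_int_superadd bNp bp) _.
  by under eq_fun do rewrite addNr.
(* Conversely, squeeze [p] between a simple [u] and [u + 1/(n+1)]: the first bounds the integral of
   [p] from below, the second that of [- p]. *)
rewrite -subr_le0; apply: le0_invn => n.
pose u (k : 'I_n.+2) : R := val (approx_val R k).
have pu x :
    u (approx_idx p n x) <= val (p x) <= u (approx_idx p n x) + n.+1%:R^-1.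
  exact: approx_bounds.
have lo : simple_int (approx_idx p n) u <= lower_int (fun x => val (p x)).
  by apply: lower_int_ge => // x; case/andP: (pu x).
have hi : simple_int (approx_idx p n) (fun k => - (u k + n.+1%:R^-1)) <=
    lower_int (fun x => - val (p x)).
  by apply: lower_int_ge => // x; rewrite lerN2; case/andP: (pu x).
rewrite simple_intN simple_intD simple_int_cst in hi.
move: lo hi; set a := simple_int _ _.
by set b := lower_int _; set c := lower_int _; set d := _^-1; lra.
Qed.

(** Superadditivity is one inequality; for the negatives, through [lower_intN], it is the other. *)
Lemma lower_int_add (p q r : X -> I01 R) :
  (forall x, val (p x) + val (q x) = val (r x)) ->
  lower_int (fun x => val (p x)) + lower_int (fun x => val (q x)) =
  lower_int (fun x => val (r x)).
Proof.
move=> pqr; apply/eqP; rewrite eq_le; apply/andP; split.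
  rewrite (_ : (fun x => val (r x)) = fun x => val (p x) + val (q x)).
    by apply: lower_int_superadd; exact: bounded_I01.
  by apply: funext => x; rewrite pqr.
rewrite -lerN2 opprD -!lower_intN.
rewrite (_ : (fun x => - val (r x)) = fun x => - val (p x) + - val (q x)).
  by apply: lower_int_superadd; apply: bounded_funN; exact: bounded_I01.
by apply: funext => x; rewrite -pqr opprD.
Qed.

(** For positive [a], [lower_int_scale_le] at [p] and at [- p] gives the two inequalities. *)
Lemma lower_int_scale (a : I01 R) (p : X -> I01 R) :
  lower_int (fun x => val a * val (p x)) =
  val a * lower_int (fun x => val (p x)).
Proof.
have [a0|a0] := eqVneq (val a) 0.
  by rewrite a0 mul0r -[RHS](lower_int_cst 0); under eq_fun do rewrite mul0r.
have {}a0 : 0 < val a by rewrite lt_def a0 I01_ge0.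
have bp := bounded_I01 p.
apply/eqP; rewrite eq_le lower_int_scale_le// andbT.
have := lower_int_scale_le a0 (bounded_funN bp).
rewrite (_ : (fun x => _ * - _) = fun x => - val (I01_mul a (p x))).
  by rewrite !lower_intN mulrN lerN2.
by apply: funext => x; rewrite mulrN.
Qed.

Fact lower_int_I01 (p : X -> I01 R) : 0 <= lower_int (fun x => val (p x)) <= 1.
Proof.
have bp := bounded_I01 p; apply/andP; split.
  rewrite -[leLHS](simple_int_cst (fun=> tt)).
  by apply: lower_int_ge => // x; exact: I01_ge0.
apply: lower_int_le => // T h u up; rewrite -[leRHS](simple_int_cst h).
by apply: simple_int_le => x; rewrite (le_trans (up x)) ?I01_le1.
Qed.

Definition integral_state : emod_hom (pow_em R X) (I01_em R).
Proof.
refine {| emod_fun := fun p : pow_em R X =>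
  in01 (lower_int_I01 p) : I01_em R |}.
- move=> p q r /pow_osumP pqr; apply/I01_osumP; apply: lower_int_add => x.
  exact/I01_osumP.
- by apply: val_inj; exact: lower_int_cst.
- by apply: val_inj; rewrite /= lower_int_cst.
- by move=> a p; apply: val_inj; exact: lower_int_scale.
Defined.

Lemma integral_stateE (p : X -> I01 R) :
  val (integral_state p) = lower_int (fun x => val (p x)).
Proof. by []. Qed.

(** The indicator and its negative are both simple for the partition into [A] and its complement, so
    their lower sums bound the integral from both sides. *)
Lemma integral_indicator A : integral_state (indicator R A) = mu A.
Proof.
apply: val_inj; rewrite integral_stateE.
have muA : simple_int (fun x => `[< A x >]) (fun b => b%:R) = val (mu A).
  rewrite /simple_int big_bool /= mulr1 mulr0 addr0; congr (val (mu _)).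
  by apply/seteqP; split=> x /asboolP.
have indE x : `[< A x >]%:R = val (indicator R A x).
  by rewrite /indicator; case: asboolP.
have bA := bounded_I01 (indicator R A).
apply/eqP; rewrite eq_le; apply/andP; split.
  rewrite -lerN2 -lower_intN -muA -simple_intN.
  by apply: lower_int_ge => [|x]; [exact: bounded_funN|rewrite indE].
by rewrite -muA; apply: lower_int_ge => // x; rewrite indE.
Qed.

End SimpleIntegral.

Lemma fin_add_prob_ext (R : realType) (X : Type) (f g : fin_add_prob R X) :
  (forall A, f A = g A) -> f = g.
Proof.
case: f g => [f f1 fU] [g g1 gU] /= /funext fg.
by subst g; congr FinAddProb; exact: Prop_irrelevance.
Qed.

Lemma measure_of_bij (R : realType) (X : Type) : bijective (@measure_of R X).
Proof.
exists (@integral_state R X) => [phi|mu].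
  by apply: state_ext => A; rewrite integral_indicator.
by apply: fin_add_prob_ext => A; exact: integral_indicator.
Qed.

(** * The right Kan extension *)

Section Kan.
Context (R : realType).
Local Notation U := (forget_fin_kleisli_dist R).
Local Notation E := (compF (emod_I01 R) (set_I01 R)).

(** * The counit *)

Section Counit.
Context (Y : fin_kleisli_dist R) (phi : E (U Y)).
Local Notation T := {classic sval Y}.

Definition counit_fun (y : sval Y) : I01 R :=
  emod_fun phi (fun d : dist R (sval Y) => d y).

Let fs : {fset T} := fset_set [set: T].

Let fsP (y : T) : y \in fs.
Proof. by rewrite /fs in_fset_set ?inE//; exact: (svalP Y). Qed.

(** For finite [Y] the expectation of [u] is a finite combination of point evaluations, which [phi]
    preserves. Constant [u] gives total mass 1; [u] the weight of [f] at a point gives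
    naturality. *)
Lemma counit_expect (u : sval Y -> I01 R) :
  \sum_(y \in [set: T]) val (counit_fun y) * val (u y) =
  val (emod_fun phi (fun d : dist R (sval Y) => expect01 d u)).
Proof.
rewrite (@fsbigTE _ _ _ _ fs) => [|y]; last by rewrite fsP.
under eq_bigr do rewrite mulrC.
apply: (state_sum (s := fs : seq T) phi (a := u)
  (p := fun y (d : dist R (sval Y)) => d y)) => d /=.
rewrite (@expectE _ _ _ _ fs) => [|y _]; last exact: fsP.
by under eq_bigr do rewrite mulrC.
Qed.

Definition counit_dist : dist R (sval Y).
Proof.
refine {| dist_fun := counit_fun |}.
- exact: sub_finite_set (svalP Y).
- transitivity (\sum_(y \in [set: T]) val (counit_fun y) * val (@I01_one R)).
    by apply: eq_fsbigr => y _; rewrite mulr1.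
  rewrite (counit_expect (fun=> I01_one)) -[RHS](state1 phi).
  congr (val (emod_fun phi _)); apply: funext => d; apply: val_inj => /=.
  exact: expect1.
Defined.

End Counit.

Definition exp_counit : nattrans (compF E U) U.
Proof.
refine (@NatTrans _ _ (compF E U) U (@counit_dist) _).
move=> Y Z f; apply: funext => phi; apply: dist_ext => z.
transitivity (expect (counit_dist phi)
  (fun y => val ((f : sval Y -> dist R _) y z))).
  exact: expect_map.
rewrite [LHS](counit_expect phi (fun y => (f : sval Y -> dist R _) y z)).
have e : (fun d => expect01 d (fun y => (f : sval Y -> dist R _) y z)) =
    (fun d => (fmor U f d : dist R (sval Z)) z).
  by apply: funext => d; apply: val_inj; apply/esym; exact: expect_map.
by have := congr1 (fun p => val (emod_fun phi p)) e; apply.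
Defined.

Definition fkl (T : finType) : fin_kleisli_dist R :=
  exist _ (T : Type) (finType_is_finite T).

(** * The lift and its uniqueness *)

Section Lift.
Context (G : functor set_cat set_cat) (g : nattrans (compF G U) U).

Definition lift_val (X : Type) (t : G X) (p : X -> I01 R) : I01 R :=
  (g (fkl bool) (fmor G (fun x : X => bern (p x)) t) : dist R bool) true.

(* A map into [D Y] followed by a Kleisli map [Y -> D 2] is a map into [D 2];
   naturality of [g] at that Kleisli map computes [lift_val]. *)
Lemma lift_val_expect (X : Type) (t : G X) (Y : fin_kleisli_dist R)
    (h : X -> dist R (sval Y)) (u : sval Y -> I01 R) :
  val (lift_val t (fun x => expect01 (h x) u)) =
  expect (g Y (fmor G (h : chom (X : set_cat) (U Y)) t) : dist R (sval Y))
    (fun y => val (u y)).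
Proof.
pose k : chom Y (fkl bool) := fun y : sval Y => bern (u y).
have kE (d : dist R (sval Y)) : (fmor U k) d = bern (expect01 d u).
  by apply: dist_bool_ext; exact: expect_map.
have hE : (fun x => bern (expect01 (h x) u)) =
    (fmor U k \c h : chom (X : set_cat) _).
  by apply: funext => x; rewrite -kE.
rewrite /lift_val hE fmorM.
have /(congr1 (fun F => F (fmor G (h : chom (X : set_cat) (U Y)) t))) /= <- :=
  natural g k.
by rewrite [LHS](congr1 (fun d : dist R bool => val (d true)) (kE _)).
Qed.

Lemma lift_val_add (X : Type) (t : G X) (p q r : X -> I01 R) :
  (forall x, val (p x) + val (q x) = val (r x)) ->
  val (lift_val t p) + val (lift_val t q) = val (lift_val t r).
Proof.
move=> pqr.
(* [p], [q] and [r] are events of one map into [D 3], with weights p, q, 1 - r. *)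
pose w x (i : 'I_3) := nth (I01_compl (r x)) [:: p x; q x] i.
have w1 x : \sum_i val (w x i) = 1.
  by rewrite !big_ord_recl big_ord0 /= addr0 addrA pqr addrC subrK.
pose h x := fin_dist (w1 x).
pose ind (A : pred 'I_3) (i : 'I_3) : I01 R :=
  if A i then I01_one else I01_zero.
have lift_ind (A : pred 'I_3) s :
    (forall x, val (s x) = \sum_i val (w x i) * val (ind A i)) ->
    val (lift_val t s) =
    expect (g (fkl 'I_3) (fmor G h t) : dist R 'I_3) (fun i => val (ind A i)).
  move=> sE; rewrite -[RHS](@lift_val_expect _ t (fkl 'I_3)).
  congr (val (lift_val t _)); apply: funext => x; apply: val_inj; rewrite sE.
  by apply/esym; exact: expect_finType.
rewrite (lift_ind (fun i => i == 0 :> nat)) => [|x]; last first.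
  by rewrite !big_ord_recl big_ord0 /w /= mulr1 !mulr0 !addr0.
rewrite (lift_ind (fun i => i == 1 :> nat)) => [|x]; last first.
  by rewrite !big_ord_recl big_ord0 /w /= mulr1 !mulr0 !addr0 add0r.
rewrite (lift_ind (fun i => i < 2)%N) => [|x]; last first.
  by rewrite !big_ord_recl big_ord0 /w /= !mulr1 mulr0 !addr0 pqr.
rewrite !expect_finType !big_ord_recl !big_ord0 /=.
by rewrite !mulr1 !mulr0 !addr0 !add0r.
Qed.

(** Scaling by [a] is the Kleisli map 2 -> D 2 that keeps [true] with probability [a] and sends
    [false] to [false]. *)
Lemma lift_val_scale (X : Type) (t : G X) (a : I01 R) (p q : X -> I01 R) :
  (forall x, val a * val (p x) = val (q x)) ->
  val (lift_val t q) = val a * val (lift_val t p).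
Proof.
move=> apq; pose u (b : bool) : I01 R := if b then a else I01_zero.
have -> : q = fun x => expect01 (bern (p x)) u.
  apply: funext => x; apply: val_inj.
  rewrite -apq [RHS](expect_finType (bern (p x))) big_bool /=.
  by rewrite mulr0 addr0 mulrC.
rewrite (@lift_val_expect _ t (fkl bool)).
rewrite (expect_finType (T := bool)) big_bool /=.
by rewrite mulr0 addr0 mulrC.
Qed.

Lemma lift_val1 (X : Type) (t : G X) :
  val (lift_val t (fun=> I01_one)) = 1.
Proof.
pose p (_ : X) : I01 R := I01_one.
have -> : (fun _ : X => I01_one) =
    fun x => expect01 (bern (p x)) (fun=> I01_one).
  apply: funext => x; apply: val_inj; apply/esym.
  exact: (expect1 (bern (p x))).
rewrite (@lift_val_expect _ t (fkl bool)); exact: expect1.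
Qed.

Definition lift_hom (X : Type) (t : G X) : E X.
Proof.
refine {| emod_fun := fun p : pow_em R X => lift_val t p : I01_em R |}.
- move=> p q r /pow_osumP pqr; apply/I01_osumP; apply: lift_val_add => x.
  exact/I01_osumP.
(* Preservation of 0 follows from 0 + 0 = 0 by cancellation. *)
- apply: val_inj; apply: (addrI (val (lift_val t (fun=> I01_zero)))).
  by rewrite /= addr0; apply: lift_val_add => x; rewrite /= addr0.
- have -> : ea1 = (fun=> I01_one) :> pow_em R X.
    by apply: funext => x; apply: val_inj; rewrite /= subr0.
  by apply: val_inj; rewrite lift_val1 /= subr0.
- by move=> a p; apply: val_inj; exact: lift_val_scale.
Defined.

Definition exp_lift : nattrans G E.
Proof.
refine (@NatTrans _ _ G E lift_hom _).
move=> X X' f; apply: funext => t; apply: emod_hom_ext => p.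
apply: val_inj => /=; rewrite /lift_val.
by rewrite (fmorM G (fun x : X' => bern (p x) : dist R bool) f).
Defined.

Lemma exp_liftE (Y : fin_kleisli_dist R) :
  exp_counit Y \c exp_lift (U Y) = g Y.
Proof.
apply: funext => t; apply: dist_ext => y.
(* [u] is the indicator of [y], so its expectation under [d] is [d y]. Then [lift_val_expect] is
   used with [h] the identity of D Y. *)
pose u z : I01 R := dirac_dist R y z.
have uE (d : dist R (sval Y)) : expect d (fun z => val (u z)) = val (d y).
  rewrite -[in RHS](bind_diracr d) bind_distE.
  apply: eq_expect => z /=; congr (_%:R); congr nat_of_bool.
  by apply: asbool_equiv_eq; split.
have := lift_val_expect t (fun d : dist R (sval Y) => d) u.
rewrite (fmorI G) uE => <-.
congr (val (lift_val t _)); apply: funext => d; apply: val_inj.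
by apply/esym; exact: uE.
Qed.

(** Naturality of [d] along [bern] after [p], a map X -> D 2, forces the value at [p]: evaluation at
    [true] composed with this map is [p] itself. *)
Lemma exp_lift_uniq (d : nattrans G E) :
  (forall Y, exp_counit Y \c d (U Y) = g Y) -> forall X, d X = exp_lift X.
Proof.
move=> dg X; apply: funext => t; apply: emod_hom_ext => p /=.
rewrite /lift_val -dg.
pose b x : dist R bool := bern (p x).
have /(congr1 (fun F => F t)) /= :=
  natural d (b : chom (X : set_cat) (U (fkl bool))).
by move=> <-.
Qed.

End Lift.

(** * Comparison of the monad structures *)

Definition exp_kan : right_kan U U :=
  RightKan exp_liftE exp_lift_uniq.

Lemma exp_codensity : is_codensity_monad U (expectation_monad R).
Proof.
exists exp_kan.
have unitE X : munit (expectation_monad R) X = codensity_unit exp_kan X.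
  by apply: funext => x; apply: emod_hom_ext.
have multE X : mmult (expectation_monad R) X = codensity_mult exp_kan X.
  (* The codensity multiplication is a lift, so by uniqueness it suffices to compare after the
     counit at finite [Y], where both sides compute to the same weights. *)
  apply: exp_lift_uniq => Y; apply: funext => P.
  exact: dist_ext.
pose i : nattrans (expectation_monad R) (codensity_monad exp_kan) :=
  id_nt exp_kan.
pose j : nattrans (codensity_monad exp_kan) (expectation_monad R) :=
  id_nt exp_kan.
exists i, j; split=> //; split=> X.
- exact: unitE.
- rewrite [LHS](ccompIm (mmult (expectation_monad R) X)) multE.
  exact: (congr1 (fun k => codensity_mult exp_kan X \c k)
            (esym (fmorI (expectation_monad R) (expectation_monad R X)))).
- exact/esym/unitE.
- rewrite [LHS](ccompIm (codensity_mult exp_kan X)) -multE.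
  exact: (congr1 (fun k => mmult (expectation_monad R) X \c k)
            (esym (fmorI (expectation_monad R) (expectation_monad R X)))).
Qed.

End Kan.

Theorem theorem6p4 (R : realType) :
  (forall X : Type, bijective (@measure_of R X)) /\
  is_codensity_monad (forget_fin_kleisli_dist R) (expectation_monad R).
Proof.
split; first by move=> X; exact: measure_of_bij.
exact: exp_codensity.
Qed.
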